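(* Let $Q=\left\{\begin{pmatrix}1&1\\1&0\end{pmatrix},\begin{pmatrix}1&0\\1&1\end{pmatrix}\right\}$, and let $n,k\ge 1$ be integers. (i) The number of $n\times k$ $01$ matrices that contain no element of $Q$ as a submatrix equals $B_{n,k}$. (ii) The number of $n\times k$ $01$ matrices that contain no element of $Q$ as a submatrix and in which every column contains at least one $1$ equals $C_{n,k}$. (iii) The number of $n\times k$ $01$ matrices that contain no element of $Q$ as a submatrix and in which every row and every column contains at least one $1$ equals $D_{n,k}$.
   Context: A submatrix of a matrix is one obtained by deleting rows and columns (keeping the order of those remaining). A $01$ matrix is lonesum if it is uniquely determined among $01$ matrices of its size by its row sum vector and column sum vector; equivalently (Ryser), it contains neither $\begin{pmatrix}1&0\\0&1\end{pmatrix}$ nor $\begin{pmatrix}0&1\\1&0\end{pmatrix}$ as a submatrix. $B_{n,k}$ is the poly-Bernoulli number $B_n^{(-k)}$, defined by $\sum_{n\ge0}B_n^{(-k)}\frac{x^n}{n!}=\frac{Li_{-k}(1-e^{-x})}{1-e^{-x}}$ with $Li_{-k}(z)=\sum_{i\ge1}i^k z^i$; equivalently (Brewbaker), $B_{n,k}$ is the number of lonesum $01$ matrices of size $n\times k$. $C_{n,k}$ is the number of lonesum $01$ matrices of size $n\times k$ in which every column contains at least one $1$. $D_{n,k}$ is the number of lonesum $01$ matrices of size $n\times k$ in which every column and every row contains at least one $1$. *)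

(* Defs.v *)
From HB Require Import structures.
From mathcomp Require Import all_boot all_order all_algebra.
Set Implicit Arguments.
Unset Strict Implicit.
Unset Printing Implicit Defensive.
Import Order.TTheory GRing.Theory Num.Theory.

(** A 01 matrix of size n x k is a term of type ['M[bool]_(n, k)]. *)

Definition increasing (p n : nat) (f : {ffun 'I_p -> 'I_n}) : bool :=
  [forall i : 'I_p, forall j : 'I_p, (i < j) ==> (f i < f j)].

(** Deleting rows and columns amounts to choosing, in increasing order, those
    that are kept. *)
Definition contains (n k p q : nat)
    (A : 'M[bool]_(n, k)) (P : 'M[bool]_(p, q)) : bool :=
  [exists f : {ffun 'I_p -> 'I_n}, exists g : {ffun 'I_q -> 'I_k},
    [&& increasing f, increasing g & mxsub f g A == P]].

Definition avoids (n k p q : nat)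
    (S : {set 'M[bool]_(p, q)}) (A : 'M[bool]_(n, k)) : bool :=
  [forall P in S, ~~ contains A P].

Definition mx22 (T : Type) (a b c d : T) : 'M[T]_2 :=
  \matrix_(i < 2, j < 2)
    if i == ord0 then (if j == ord0 then a else b)
    else (if j == ord0 then c else d).

Definition Q : {set 'M[bool]_2} :=
  [set mx22 true true
            true false;
       mx22 true false
            true true].

Definition row_sum (n k : nat) (A : 'M[bool]_(n, k)) (i : 'I_n) : nat :=
  \sum_(j < k) A i j.

Definition col_sum (n k : nat) (A : 'M[bool]_(n, k)) (j : 'I_k) : nat :=
  \sum_(i < n) A i j.

Definition lonesum (n k : nat) (A : 'M[bool]_(n, k)) : bool :=
  [forall A' : 'M[bool]_(n, k),
     [forall i : 'I_n, row_sum A' i == row_sum A i] &&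
     [forall j : 'I_k, col_sum A' j == col_sum A j] ==> (A' == A)].

Definition rows_nonzero (n k : nat) (A : 'M[bool]_(n, k)) : bool :=
  [forall i : 'I_n, exists j : 'I_k, A i j].

Definition cols_nonzero (n k : nat) (A : 'M[bool]_(n, k)) : bool :=
  [forall j : 'I_k, exists i : 'I_n, A i j].

Definition C_number (n k : nat) : nat :=
  #|[set A : 'M[bool]_(n, k) | lonesum A && cols_nonzero A]|.

Definition D_number (n k : nat) : nat :=
  #|[set A : 'M[bool]_(n, k) | [&& lonesum A, rows_nonzero A & cols_nonzero A]]|.

Local Open Scope ring_scope.

(** Formal power series over the rationals, as coefficient sequences. *)
Definition fps := nat -> rat.

Definition fps_one : fps := fun n => (n == 0%N)%:R.

Definition fps_mul (f g : fps) : fps :=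
  fun n => \sum_(i < n.+1) f i * g (n - i)%N.

Definition fps_exp (f : fps) (m : nat) : fps :=
  iter m (fun h => fps_mul h f) fps_one.

(** The substitution f(g(x)), meaningful when g has zero constant term: then
    g^i has no term of degree n < i, so that the sum may stop at i = n. *)
Definition fps_comp (f g : fps) : fps :=
  fun n => \sum_(i < n.+1) f i * fps_exp g i n.

(** f(z) / z, for f with zero constant term. *)
Definition fps_divX (f : fps) : fps := fun n => f n.+1.

Definition egf (u : nat -> rat) : fps := fun n => u n / n`!%:R.

(** 1 - exp(-x) *)
Definition one_sub_expN : fps := fun n => fps_one n - (-1) ^+ n / n`!%:R.

(** [polylog_neg k] is Li_{-k}(z) = \sum_(i >= 1) i^k z^i. The case i = 0 is
    singled out because 0 ^+ 0 = 1. *)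
Definition polylog_neg (k : nat) : fps :=
  fun i => if i == 0%N then 0 else i%:R ^+ k.

(** [poly_bernoulli n k] is B_n^(-k), that is, n! times the coefficient of x^n
    in Li_{-k}(1 - exp(-x)) / (1 - exp(-x)). As the ring of formal power series
    has no division by 1 - exp(-x), the quotient Li_{-k}(z) / z is formed before
    substituting z = 1 - exp(-x); [poly_bernoulli_gf] and
    [poly_bernoulli_unique] below show that this is the quotient. *)
Definition poly_bernoulli (n k : nat) : rat :=
  n`!%:R * fps_comp (fps_divX (polylog_neg k)) one_sub_expN n.

Lemma one_sub_expN0 : one_sub_expN 0 = 0.
Proof. by rewrite /one_sub_expN /fps_one expr0 fact0 divr1 subrr. Qed.

Lemma fps_exp_small (g : fps) (i n : nat) :
  g 0%N = 0 -> (n < i)%N -> fps_exp g i n = 0.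
Proof.
move=> g0; elim: i n => [//|i IHi] n.
rewrite ltnS leq_eqVlt => lt_ni; rewrite /fps_exp iterS -/(fps_exp g i) /fps_mul big1 // => j _.
have [lt_ji | le_ij] := ltnP j i; first by rewrite IHi ?mul0r.
suff /eqP -> : (n - j == 0)%N by rewrite g0 mulr0.
by rewrite subn_eq0 (leq_trans _ le_ij) // leq_eqVlt.
Qed.

Lemma poly_bernoulli_gf (k : nat) :
  fps_mul (egf (poly_bernoulli^~ k)) one_sub_expN
    =1 fps_comp (polylog_neg k) one_sub_expN.
Proof.
move=> n; have z0 := one_sub_expN0; set z := one_sub_expN in z0 *.
rewrite /fps_comp big_ord_recl {1}/polylog_neg eqxx mul0r add0r.
transitivity (\sum_(i < n.+1) polylog_neg k i.+1 * fps_exp z i.+1 n); last first.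
  by rewrite big_ord_recr (@fps_exp_small z n.+1) // mulr0; exact: addr0.
under [RHS]eq_bigr => i _ do rewrite /fps_exp iterS -/(fps_exp z i) big_distrr /=.
rewrite exchange_big /=; apply: eq_bigr => j _.
have fact0 : j`!%:R != 0 :> rat by rewrite pnatr_eq0 -lt0n fact_gt0.
rewrite /egf /poly_bernoulli (mulrC j`!%:R) mulfK //.
under [RHS]eq_bigr => i _ do rewrite mulrA.
rewrite -big_distrl /= /fps_comp; congr (_ * _).
rewrite (big_ord_widen n.+1 (fun i => fps_divX (polylog_neg k) i * fps_exp z i j))
  ?ltn_ord // [RHS](bigID (fun i : 'I_n.+1 => (i < j.+1)%N)) /=.
rewrite [X in _ = _ + X]big1 ?addr0 // => i; rewrite -leqNgt => lt_ji.
by rewrite fps_exp_small ?mulr0.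
Qed.

Lemma poly_bernoulli_unique (k : nat) (u : nat -> rat) :
  fps_mul (egf u) one_sub_expN =1 fps_comp (polylog_neg k) one_sub_expN ->
  u =1 poly_bernoulli^~ k.
Proof.
move=> Hu n; elim/ltn_ind: n => n IHn.
have := etrans (Hu n.+1) (esym (poly_bernoulli_gf k n.+1)).
rewrite /fps_mul !big_ord_recr /= subnn one_sub_expN0 !mulr0 !addr0.
under eq_bigr => i _ do rewrite {1}/egf (IHn i (ltn_ord i)).
move=> /addrI; rewrite subSnn.
have z1 : one_sub_expN 1 = 1.
  by rewrite /one_sub_expN /fps_one expr1 divr1 sub0r opprK.
rewrite z1 !mulr1 /egf => /mulIf -> //.
by rewrite invr_eq0 pnatr_eq0 -lt0n fact_gt0.
Qed.

(* Main.v *)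
Require Import Defs.
From HB Require Import structures.
From mathcomp Require Import all_boot all_order all_algebra perm ring.
Import Order.TTheory GRing.Theory Num.Theory.
Set Implicit Arguments.
Unset Strict Implicit.
Unset Printing Implicit Defensive.

(** A 01 matrix is read as the sequence of its columns, each a set of rows.
    Both properties then become conditions on pairs of columns:

    - avoiding [Q] says that every column [d] to the right of [c] either is
      disjoint from [c] or contains it ([respects], [avoidsE]): as soon as two
      rows share a 1, they agree in all later columns;
    - being lonesum says that the columns form a chain under inclusion
      ([nested], [lonesumE]); this is Ryser's theorem.

    Both counts satisfy one and the same recurrence in the number of columns.
    On the side of [Q], let [M] be the first column. If [M] is not empty, its
    rows agree from then on, so that they can be merged into one row and the
    first column deleted. On the lonesum side, let [c] be the first column and
    let [M] be the set of the rows of [c] that are least as 01 vectors among the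
    rows of [c]. These rows are equal, so again they can be merged into one,
    after which column [c] is deleted. Nothing is lost: [c] consists of [M] and of
    the rows larger than the merged row ([bottom], [upset], [bottomK],
    [upsetK]). In both cases a nonempty set [M] of rows is replaced by a single
    row and one column is removed ([card_merge]), and an empty first column is
    just removed.

    To treat the three parts at once, the count has two parameters: a boolean
    that allows or forbids empty columns, and a set [E] of rows that may be zero.
    A merged row has already met a 1 and joins [E]. The equality of the two counts
    ([count_respects_nested]) is then an immediate induction and gives (ii) and
    (iii) by choosing the parameters.

    For (i), the recurrence reads
    f(n, k+1) = f(n, k) + sum_(s >= 1) binom(n, s) f(n - s + 1, k), f(n, 0) = 1,
    and the poly-Bernoulli numbers satisfy it too. Indeed
    B_n^(-k) = sum_i (i+1)^k a(i, n), where a(i, n) is n! times the coefficient of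
    x^n in A_i = (1 - exp(-x))^i, and the recurrence follows, one i at a time, from
    i a(i, n) = sum_(s >= 1) binom(n, s) a(i, n - s + 1), which is the coefficient
    form of (exp(x) - 1) A_i' = i A_i ([ecoef_rec]). *)

(** * Poly-Bernoulli numbers *)

Section PolyBernoulli.
Local Open Scope ring_scope.

(** The exponential coefficients of (1 - exp(-x))^i, the numbers a(i, n) above. *)
Definition ecoef (i n : nat) : rat := n`!%:R * fps_exp one_sub_expN i n.

Lemma ecoef_small i n : (n < i)%N -> ecoef i n = 0.
Proof. by move=> ltni; rewrite /ecoef fps_exp_small ?mulr0 ?one_sub_expN0. Qed.

(** The relation A_(i+1) = A_i - exp(-x) A_i. *)
Lemma ecoefS i n :
  ecoef i.+1 n = ecoef i n
    - \sum_(t < n.+1) 'C(n, t)%:R * (-1) ^+ (n - t) * ecoef i t.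
Proof.
have fact_neq0 m : m`!%:R != 0 :> rat by rewrite pnatr_eq0 -lt0n fact_gt0.
rewrite /ecoef [fps_exp _ i.+1]/fps_exp iterS -/(fps_exp _ i) /fps_mul big_distrr /=.
have e (t : 'I_n.+1) : n`!%:R * (fps_exp one_sub_expN i t * one_sub_expN (n - t)%N) =
   (if t == ord_max then n`!%:R * fps_exp one_sub_expN i n else 0)
    - 'C(n, t)%:R * (-1) ^+ (n - t) * (t`!%:R * fps_exp one_sub_expN i t).
  have tn : (t <= n)%N by rewrite -ltnS.
  rewrite -(bin_fact tn) !natrM [one_sub_expN (n - t)%N]/one_sub_expN !mulrBr.
  congr (_ - _); last first.
    move: (fps_exp _ _ _) ((-1) ^+ (n - t)%N) => x y.
    by field; apply: fact_neq0.
  rewrite /fps_one subn_eq0 -val_eqE /= eqn_leq tn /=.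
  case: ifP => [le_nt|_]; last by rewrite !mulr0.
  have -> : nat_of_ord t = n by apply/eqP; rewrite eqn_leq tn.
  by rewrite subnn binn fact0 !mulr1 mul1r.
under eq_bigr do rewrite e.
by rewrite big_split /= -big_mkcond /= big_pred1_eq sumrN.
Qed.

(** The binomial expansion of (1 - exp(-x))^i as a combination of the exp(-jx).
    The bound [N] is free so that the induction on [i] keeps a common range of
    summation; the terms with [j > i] vanish. *)
Lemma ecoefE i n N : (i <= N)%N ->
  ecoef i n = \sum_(j < N.+1) (-1) ^+ j * 'C(i, j)%:R * (- j%:R) ^+ n.
Proof.
elim: i n => [|i IHi] n leiN.
  rewrite big_ord_recl big1 ?addr0 => [|j _]; last by rewrite bin0n /= mulr0 mul0r.
  rewrite /ecoef /fps_exp /= /fps_one bin0 oppr0 expr0n !mul1r.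
  by case: n => [|n]; rewrite ?fact0 ?mulr1 ?mulr0.
rewrite ecoefS.
under eq_bigr do rewrite (IHi _ (ltnW leiN)) big_distrr /=.
rewrite exchange_big /=.
have -> : \sum_(j < N.+1) \sum_(t < n.+1) 'C(n, t)%:R * (-1) ^+ (n - t)
              * ((-1) ^+ j * 'C(i, j)%:R * (- j%:R) ^+ t)
   = \sum_(j < N.+1) (-1) ^+ j * 'C(i, j)%:R * (- j.+1%:R) ^+ n :> rat.
  apply: eq_bigr => j _.
  rewrite -natr1 opprD addrC exprDn big_distrr /=; apply: eq_bigr => t _.
  by rewrite -mulr_natl; ring.
rewrite (IHi n (ltnW leiN)) big_ord_recl [RHS]big_ord_recl !bin0 -addrA; congr (_ + _).
rewrite [X in _ - X]big_ord_recr /= (bin_small leiN) mulr0 mul0r addr0.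
rewrite -sumrB; apply: eq_bigr => j _ /=.
by rewrite /bump add1n binS natrD exprS; ring.
Qed.

(** The derivative of A_(i+1) is (i+1) A_i exp(-x) = (i+1) (A_i - A_(i+1)). *)
Lemma ecoef_deriv i n : ecoef i.+1 n.+1 = i.+1%:R * (ecoef i n - ecoef i.+1 n).
Proof.
rewrite (ecoefE n.+1 (leqnn i.+1)) (ecoefE n (leqnSn i)) (ecoefE n (leqnn i.+1)).
rewrite -sumrB big_distrr /=; apply: eq_bigr => -[[|j] lt_j] _ /=.
  by rewrite exprS !bin0 oppr0; ring.
have := congr1 (fun m => m%:R : rat) (mul_bin_diag i.+1 j).
rewrite !natrM /= => e.
rewrite [_ ^+ n.+1]exprS.
transitivity ((-1) ^+ j.+1 * - (j.+1%:R * 'C(i.+1, j.+1)%:R) * (- j.+1%:R) ^+ n : rat).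
  by ring.
by rewrite -e binS natrD; ring.
Qed.

(** The identity (exp(x) - 1) A_i' = i A_i. After the expansion of A_i, the
    difference of the two sides telescopes in [j]. *)
Lemma ecoef_rec i n :
  i%:R * ecoef i n = \sum_(s < n) 'C(n, s.+1)%:R * ecoef i (n - s).
Proof.
rewrite (ecoefE n (leqnn i)).
under [RHS]eq_bigr do rewrite (ecoefE _ (leqnn i)) big_distrr /=.
rewrite exchange_big /=.
have -> : \sum_(j < i.+1) \sum_(s < n) 'C(n, s.+1)%:R *
      ((-1) ^+ j * 'C(i, j)%:R * (- j%:R) ^+ (n - s))
  = \sum_(j < i.+1) (-1) ^+ j * 'C(i, j)%:R
       * (- j%:R * ((1 - j%:R) ^+ n - (- j%:R) ^+ n)) :> rat.
  apply: eq_bigr => j _.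
  rewrite (addrC 1) exprDn big_ord_recl /= subn0 expr0 mulr1 bin0 mulr1n addrC addKr.
  rewrite !big_distrr /=; apply: eq_bigr => s _.
  rewrite expr1n mulr1 /bump add1n.
  have -> : (n - s = (n - s.+1).+1)%N by rewrite subnSK.
  by rewrite exprS -mulr_natl; ring.
rewrite big_distrr /=; apply/eqP; rewrite -subr_eq0 -sumrB.
pose h (j : nat) : rat := (-1) ^+ j * 'C(i, j)%:R * j%:R * (1 - j%:R) ^+ n.
rewrite -(big_mkord xpredT (fun j : nat => i%:R * ((-1) ^+ j * 'C(i, j)%:R * (- j%:R) ^+ n) -
   (-1) ^+ j * 'C(i, j)%:R * (- j%:R * ((1 - j%:R) ^+ n - (- j%:R) ^+ n)))).
rewrite (eq_big_nat _ _ (F2 := fun j => - (h j.+1 - h j))) => [|j /andP[_ lt_ji]].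
  by rewrite sumrN telescope_sumr // /h bin_small // !(mulr0, mul0r) subrr oppr0.
have := congr1 (fun m => m%:R : rat) (mul_bin_left i j).
rewrite !natrM natrB // => e.
have e1 : 1 - j.+1%:R = - j%:R :> rat by rewrite -natr1 opprD addrCA subrr addr0.
rewrite /h e1 exprS.
transitivity ((-1) ^+ j * ((i%:R - j%:R) * 'C(i, j)%:R) * (- j%:R) ^+ n
   + (-1) ^+ j * 'C(i, j)%:R * j%:R * (1 - j%:R) ^+ n : rat); first by ring.
by rewrite -e; ring.
Qed.

(** Raising the truncation [n] to any [N] allows one range of summation for the
    numbers B_(n-s)^(-k) of different indices. *)
Lemma poly_bernoulli_ecoef k n N : (n <= N)%N ->
  poly_bernoulli n k = \sum_(i < N.+1) i.+1%:R ^+ k * ecoef i n.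
Proof.
move=> le_nN; rewrite /poly_bernoulli /fps_comp big_distrr /=.
rewrite (big_ord_widen N.+1 (fun i =>
  n`!%:R * (fps_divX (polylog_neg k) i * fps_exp one_sub_expN i n))) //.
rewrite big_mkcond; apply: eq_bigr => i _.
rewrite /ecoef [RHS]mulrCA /fps_divX /polylog_neg /=.
by case: ltnP => // lt_ni; rewrite fps_exp_small ?mulr0 ?one_sub_expN0.
Qed.

(** The sum over [i] of A_i is 1 / exp(-x) = exp(x). On coefficients,
    [ecoef_deriv] and a summation by parts show that the value does not depend
    on [n]. *)
Lemma poly_bernoulli0 n : poly_bernoulli n 0 = 1.
Proof.
elim: n => [|n IHn]; rewrite (poly_bernoulli_ecoef _ (leqnn _)).
  by rewrite big_ord1 expr0 /ecoef /fps_exp /= /fps_one !mul1r.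
rewrite -IHn (poly_bernoulli_ecoef _ (leqnn _)) big_ord_recl.
have -> : ecoef 0 n.+1 = 0 by rewrite /ecoef /fps_exp /= /fps_one mulr0.
rewrite mulr0 add0r; apply/eqP; rewrite -subr_eq0 -sumrB.
rewrite (eq_bigr (fun i : 'I_n.+1 => - (i.+1%:R * ecoef i.+1 n - i%:R * ecoef i n))).
  rewrite -(big_mkord xpredT (fun i => - (i.+1%:R * ecoef i.+1 n - i%:R * ecoef i n))).
  by rewrite sumrN telescope_sumr // ecoef_small // mulr0 mul0r subrr oppr0.
by move=> i _; rewrite /= /bump add1n ecoef_deriv !expr0 -[in RHS]natr1; rewrite -natr1; ring.
Qed.

Lemma poly_bernoulli_rec n k :
  poly_bernoulli n k.+1 = poly_bernoulli n k
    + \sum_(s < n) 'C(n, s.+1)%:R * poly_bernoulli (n - s) k.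
Proof.
rewrite !(poly_bernoulli_ecoef _ (leqnn n)).
under [X in _ + X]eq_bigr => s _ do
  rewrite (poly_bernoulli_ecoef _ (leq_subr s n)) big_distrr /=.
rewrite exchange_big -big_split /=; apply: eq_bigr => i _.
under eq_bigr do rewrite mulrCA.
by rewrite -big_distrr -ecoef_rec -mulrDr exprS -natr1 /=; ring.
Qed.
End PolyBernoulli.

(** * Sequences of columns and their recurrence *)

Section Columns.
Variable T : finType.
Implicit Types (b : bool) (c d M V E : {set T}) (cs : seq {set T}) (r : rel {set T}).

Definition respects M d := [disjoint M & d] || (M \subset d).
Definition nested c d := (c \subset d) || (d \subset c).

(** [V] is the set of rows that remain after merging, so that all the matrices of
    the recurrence have their rows in one type; [E] holds the exempt rows. *)
Definition admissible b V E cs :=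
  [&& all (fun c => c \subset V) cs, b || (set0 \notin cs)
    & V \subset E :|: \bigcup_(c <- cs) c].

Definition count_cols r b V E k :=
  #|[set t : k.-tuple {set T} | pairwise r t && admissible b V E t]|.

Lemma mem_bigcup_seq (P : pred {set T}) cs y :
  (y \in \bigcup_(c <- cs | P c) c) = has (fun c => P c && (y \in c)) cs.
Proof.
elim: cs => [|c cs IH]; rewrite ?big_nil ?big_cons ?inE //= -IH.
by case: (P c); rewrite ?inE.
Qed.

Lemma card_tuple_cons k (P : pred (seq {set T})) :
  #|[set t : k.+1.-tuple {set T} | P t]|
    = \sum_c #|[set t : k.-tuple {set T} | P (c :: t)]|.
Proof.
under eq_bigr do rewrite cardsE -sum1_card.
rewrite pair_big_dep /= cardsE -sum1_card.
rewrite (reindex (fun p : {set T} * k.-tuple {set T} => cons_tuple p.1 p.2)) //=.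
exists (fun t => (thead t, behead_tuple t)) => [[c t] _|t _] /=.
  by congr (_, _); apply: val_inj.
by rewrite [RHS]tuple_eta; apply: val_inj.
Qed.

Lemma card_can_in (A B : finType) (P : {set A}) (R : {set B}) (f : A -> B) (g : B -> A) :
  {in P, forall x, f x \in R} -> {in R, forall y, g y \in P} ->
  {in P, cancel f g} -> {in R, cancel g f} -> #|P| = #|R|.
Proof.
move=> fR gP fK gK; rewrite -(card_in_imset (can_in_inj fK)); apply/eq_card => y.
apply/imsetP/idP => [[x Px ->]|Ry]; first exact: fR.
by exists (g y); rewrite ?gK //; apply: gP.
Qed.

(** The rows of [M] are merged into the row [x] of [M] by deleting the others.
    Columns that respect [M] take one value on all of [M], so the deletion is
    reversible on them, and it preserves inclusion and disjointness. *)
Section Merge.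
Variables (M V E : {set T}) (x : T).
Hypotheses (xM : x \in M) (sMV : M \subset V).

Definition merge d := d :\: (M :\ x).
Definition unmerge d := if x \in d then M :|: d else d.

Lemma respects_in d y : respects M d -> y \in M -> (y \in d) = (x \in d).
Proof.
case/orP=> [dis|/subsetP sMd] yM; last by rewrite !sMd.
by rewrite !(disjointFr dis).
Qed.

Lemma mergeK d : respects M d -> unmerge (merge d) = d.
Proof.
move=> Md; apply/setP=> y; rewrite /unmerge /merge.
have := @respects_in d y Md.
rewrite !inE eqxx /= => h; case: ifP => xd; rewrite ?inE;
  case: (boolP (y \in M)) h => yM h; rewrite ?andbF ?andbT ?orbF //=.
- by rewrite h.
- by rewrite h // xd andbF.
Qed.

Lemma unmergeK d : d \subset x |: (V :\: M) -> merge (unmerge d) = d.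
Proof.
move/subsetP=> sd; apply/setP=> y; rewrite /unmerge /merge.
have := sd y; rewrite !inE; case: ifP => xd; rewrite ?inE.
  by case: eqVneq => [->|_] //=; rewrite ?xd ?orbT //; case: (y \in M) => //= h;
   case: (y \in d) h => // /(_ isT).
case: eqVneq => [->|_] //=; case: (y \in M) => //= h.
by case: (y \in d) h => // /(_ isT).
Qed.

Lemma respects_unmerge d : d \subset x |: (V :\: M) -> respects M (unmerge d).
Proof.
move/subsetP=> sd; rewrite /respects /unmerge; case: ifP => xd.
  by rewrite subsetUl orbT.
rewrite disjoint_subset; apply/orP; left; apply/subsetP=> y yM; rewrite !inE.
by apply/negP=> yd; have := sd y yd; rewrite !inE yM orbF => /eqP yx; rewrite -yx yd in xd.
Qed.

Lemma merge_sub d : d \subset V -> merge d \subset x |: (V :\: M).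
Proof.
move/subsetP=> sd; apply/subsetP=> y; rewrite !inE negb_and negbK => /andP[h /sd ->].
by rewrite andbT.
Qed.

Lemma unmerge_sub d : d \subset x |: (V :\: M) -> unmerge d \subset V.
Proof.
have sV : x |: (V :\: M) \subset V.
  by rewrite subUset sub1set (subsetP sMV) //= subsetDl.
by move=> sd; rewrite /unmerge; case: ifP; rewrite ?subUset ?sMV /= (subset_trans sd sV).
Qed.

Lemma merge_subset d1 d2 : respects M d1 -> respects M d2 ->
  (merge d1 \subset merge d2) = (d1 \subset d2).
Proof.
move=> M1 M2; apply/idP/idP => [/subsetP s|]; last exact: setSD.
apply/subsetP=> y y1; case: (boolP (y \in M)) => yM.
  rewrite (respects_in M2 yM); have := s x; rewrite !inE eqxx /= -(respects_in M1 yM).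
  exact.
by have := s y; rewrite !inE (negPf yM) andbF y1; apply.
Qed.

Lemma merge_disjoint d1 d2 : respects M d1 -> respects M d2 ->
  [disjoint merge d1 & merge d2] = [disjoint d1 & d2].
Proof.
move=> M1 M2; rewrite -!setI_eq0; apply/eqP/eqP => /setP e; apply/setP => y;
  have := e y; rewrite !inE; last first.
  by move=> e'; apply/negP=> /andP[/andP[_ y1] /andP[_ y2]]; rewrite y1 y2 in e'.
case: (boolP (y \in M)) => yM; last by rewrite andbF.
by rewrite (respects_in M1 yM) (respects_in M2 yM); have := e x; rewrite !inE eqxx.
Qed.

Lemma merge_eq0 d : respects M d -> (merge d == set0) = (d == set0).
Proof.
move=> Md; rewrite -!subset0 -[in LHS](set0D (M :\ x)) merge_subset //.
by rewrite /respects -setI_eq0 setI0 eqxx.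
Qed.

(** The column [M] covers exactly the merged rows, so after its removal the row
    [x], which represents them, has to be exempt from being nonzero. *)
Lemma merge_admissible b cs : all (respects M) cs -> all (fun c => c \subset V) cs ->
  admissible b V E (M :: cs)
   = admissible b (x |: (V :\: M)) (x |: E) (map merge cs).
Proof.
move=> Mcs Vcs; rewrite /admissible /= sMV Vcs /=.
have -> /= : all (fun c => c \subset x |: V :\: M) (map merge cs).
  by rewrite all_map; apply/allP=> d dcs /=; apply: merge_sub; exact: (allP Vcs).
congr (_ && _).
  rewrite inE negb_or eq_sym -subset0; have -> /= : ~~ (M \subset set0).
      by apply/negP=> /subsetP/(_ x xM); rewrite inE.
    congr (_ || ~~ _); apply/idP/mapP => [c0|[d dcs /esym/eqP]].
      by exists set0; rewrite // /merge set0D.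
    by rewrite merge_eq0 ?(allP Mcs) // => /eqP <-.
apply/subsetP/subsetP => h y.
  rewrite !inE => /orP[/eqP ->|/andP[yM yV]]; first by rewrite eqxx.
  have := h y yV; rewrite big_cons !inE (negPf yM) /= => /orP[->|]; first by rewrite orbT.
  rewrite !mem_bigcup_seq => /hasP[d dcs yd]; apply/orP; right.
  by rewrite has_map; apply/hasP; exists d; rewrite //= !inE (negPf yM) andbF.
move=> yV; rewrite big_cons !inE; case: (boolP (y \in M)) => [|yM]; first by rewrite orbT.
have := h y; rewrite !inE yV yM orbT => /(_ isT).
case: eqVneq => [yx|_] /=; first by rewrite yx xM in yM.
case/orP => [->//|]; rewrite !mem_bigcup_seq has_map => /hasP[d dcs /=].
rewrite !inE => /andP[_ yd].
by apply/orP; right; apply/hasP; exists d.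
Qed.

Lemma card_merge r b k :
  (forall d1 d2, respects M d1 -> respects M d2 -> r (merge d1) (merge d2) = r d1 d2) ->
  #|[set t : k.-tuple {set T} |
       [&& all (respects M) t, pairwise r t & admissible b V E (M :: t)]]|
    = count_cols r b (x |: (V :\: M)) (x |: E) k.
Proof.
move=> hr.
have pm cs : all (respects M) cs -> pairwise r (map merge cs) = pairwise r cs.
  move=> Mcs; rewrite pairwise_map; apply/eq_in_pairwise: Mcs.
  by move=> d1 d2; apply: hr.
apply: (card_can_in (f := map_tuple merge) (g := map_tuple unmerge)) => t; rewrite !inE.
- case/and3P=> Mt rt At; have Vt : all (fun c => c \subset V) t.
    by case/and3P: At => /= /andP[_ ->].
  by rewrite /= pm // rt -merge_admissible.
- case/andP=> rt At; have := At; case/and3P=> Vt _ _.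
  have Mu : all (respects M) (map unmerge t).
    by rewrite all_map; apply/allP=> d /(allP Vt); apply: respects_unmerge.
  have Vu : all (fun c => c \subset V) (map unmerge t).
    by rewrite all_map; apply/allP=> d /(allP Vt); apply: unmerge_sub.
  rewrite Mu merge_admissible // -pm // -map_comp.
  have -> : map (merge \o unmerge) t = t.
    by rewrite -[RHS]map_id; apply/eq_in_map=> d /(allP Vt); apply: unmergeK.
  by rewrite rt.
- case/and3P=> Mt _ _; apply/val_inj; rewrite /= -map_comp -[RHS]map_id.
  by apply/eq_in_map=> d /(allP Mt); apply: mergeK.
- case/andP=> _ /and3P[Vt _ _]; apply/val_inj; rewrite /= -map_comp -[RHS]map_id.
  by apply/eq_in_map=> d /(allP Vt); apply: unmergeK.
Qed.
End Merge.

(** * Recurrence for chains of columns *)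

(** When [c :: cs] is a chain, the rows of [c] that are minimal as 01 vectors
    among the rows of [c] are those that lie in no column strictly inside [c]. *)
Definition bottom c cs := c :\: \bigcup_(d <- cs | ~~ (c \subset d)) d.
(** The rows of [M] together with those strictly larger than them as 01 vectors,
    when [cs] is a chain of columns that respect [M]: inverse to [bottom]. The
    condition that [M] is not inside [d], rather than disjoint from it, makes the
    empty [M] correspond to the empty column. *)
Definition upset M cs := M :|: \bigcup_(d <- cs | ~~ (M \subset d)) d.

Lemma bottomP c cs y :
  reflect (y \in c /\ {in cs, forall d, y \in d -> c \subset d}) (y \in bottom c cs).
Proof.
rewrite inE mem_bigcup_seq andbC -all_predC; apply: (iffP andP) => -[yc h]; split=> //.
  by move=> d dcs yd; have := allP h d dcs; rewrite /= yd andbT negbK.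
by apply/allP=> d dcs /=; apply/negP=> /andP[/negP ncd yd]; apply/ncd/h.
Qed.

Lemma upsetP M cs y :
  reflect (y \in M \/ exists d, [/\ d \in cs, ~~ (M \subset d) & y \in d])
    (y \in upset M cs).
Proof.
rewrite inE mem_bigcup_seq; apply: (iffP orP) => -[yM|]; first by left.
- by case/hasP=> d dcs /andP[? ?]; right; exists d.
- by left.
- by case=> d [dcs ? ?]; right; apply/hasP; exists d => //; apply/andP.
Qed.

(** The columns strictly inside [c] form a chain, so their union is one of them
    or empty, and it is not [c]. *)
Lemma bottom_neq0 c cs : all (nested c) cs -> pairwise nested cs ->
  c != set0 -> exists y, y \in bottom c cs.
Proof.
move=> ccs ncs c0.
suff [y yc yN] : exists2 y, y \in c & {in cs, forall d, y \in d -> c \subset d}.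
  by exists y; apply/bottomP.
elim: cs ccs ncs => [|d cs IH] /=; first by have /set0Pn[y] := c0; exists y.
case/andP=> nd ccs /andP[/allP dcs /IH-/(_ ccs) [y yc yN]].
have [cd|ncd] := boolP (c \subset d).
  by exists y => // e; rewrite inE => /orP[/eqP->|/yN].
have [yd|nyd] := boolP (y \in d); last first.
  by exists y => // e; rewrite inE => /orP[/eqP-> yd|/yN //]; rewrite yd in nyd.
have /subsetPn[z zc zd] := ncd; exists z => // e; rewrite inE => /orP[/eqP->|ecs ze].
  by rewrite (negPf zd).
have /orP[de|ed] := dcs e ecs; first by apply: (yN e ecs); apply: (subsetP de).
by rewrite (subsetP ed) in zd.
Qed.

Lemma bottom_subset c cs d : all (nested c) cs -> pairwise nested cs -> d \in cs ->
  (bottom c cs \subset d) = (c \subset d).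
Proof.
move=> ccs ncs dcs; apply/idP/idP => [ld|cd]; last exact: subset_trans (subsetDl _ _) cd.
have [->|c0] := eqVneq c set0; first exact: sub0set.
have [y yl] := bottom_neq0 ccs ncs c0.
by have /bottomP[_ /(_ d dcs)] := yl; apply; apply: (subsetP ld).
Qed.

Lemma bottomK c cs : all (nested c) cs -> pairwise nested cs ->
  upset (bottom c cs) cs = c.
Proof.
move=> ccs ncs; apply/setP=> y; apply/upsetP/idP => [[/bottomP[]//|[d [dcs]]]|yc].
  rewrite (bottom_subset ccs) // => ncd; have := allP ccs d dcs.
  by rewrite /nested (negPf ncd) /= => /subsetP; apply.
have [|/bottomP nl] := boolP (y \in bottom c cs); first by left.
right; have [/hasP[d dcs /andP[yd ncd]]|/hasPn h] :=
  boolP (has (fun d : {set T} => (y \in d) && ~~ (c \subset d)) cs).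
  by exists d; rewrite bottom_subset.
case: nl; split=> // d dcs yd; have := h d dcs.
by rewrite yd /= negbK.
Qed.

Lemma bottom_respects c cs : all (nested c) cs -> pairwise nested cs ->
  all (respects (bottom c cs)) cs.
Proof.
move=> ccs ncs; apply/allP=> d dcs; rewrite /respects (bottom_subset ccs) //.
case: (boolP (c \subset d)) => cd; first by rewrite orbT.
rewrite orbF disjoint_subset; apply/subsetP=> y /bottomP[_ /(_ d dcs)] h.
by rewrite inE; apply: contra cd.
Qed.

Lemma upset_subset M cs d : pairwise nested cs -> d \in cs ->
  (upset M cs \subset d) = (M \subset d).
Proof.
move=> ncs dcs; apply/idP/idP => [|Md]; first exact: subset_trans (subsetUl _ _).
apply/subsetP=> y /upsetP[/(subsetP Md)//|[e [ecs nMe ye]]].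
have : nested e d.
  have nr : reflexive nested by move=> z; rewrite /nested subxx.
  have ns : symmetric nested by move=> z1 z2; rewrite /nested orbC.
  by rewrite pairwise_all2rel // in ncs; apply: (allrelP ncs).
case/orP=> [ed|de]; first exact: (subsetP ed).
by rewrite (subset_trans Md de) in nMe.
Qed.

Lemma upset_nested M cs : pairwise nested cs -> all (nested (upset M cs)) cs.
Proof.
move=> ncs; apply/allP=> d dcs; rewrite /nested upset_subset //.
have [//|nMd] := boolP (M \subset d); apply/subsetP=> y yd.
by apply/upsetP; right; exists d.
Qed.

Lemma upsetK M cs : all (respects M) cs -> pairwise nested cs ->
  bottom (upset M cs) cs = M.
Proof.
move=> Mcs ncs; apply/setP=> y; apply/bottomP/idP => [[/upsetP[//|[d [dcs nMd yd]]] h]|yM].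
  by have := h d dcs yd; rewrite upset_subset // (negPf nMd).
split=> [|d dcs yd]; first by apply/upsetP; left.
rewrite upset_subset //; have /orP[dis|//] := allP Mcs d dcs.
by rewrite (disjointFr dis yM) in yd.
Qed.

Lemma upset_admissible b V E M cs :
  admissible b V E (upset M cs :: cs) = admissible b V E (M :: cs).
Proof.
rewrite /admissible /= !inE !big_cons; congr [&& _, _ & _].
- case: allP => [Vcs|_]; rewrite ?andbF // !andbT subUset; case: (M \subset V) => //=.
  by apply/subsetP=> y; rewrite mem_bigcup_seq => /hasP[d /Vcs/subsetP sd /andP[_ /sd]].
- congr (_ || ~~ (_ || _)); rewrite ![set0 == _]eq_sym setU_eq0.
  case: eqVneq => //= ->; rewrite big1 ?eqxx // => d.
  by rewrite sub0set.
congr (V \subset _ :|: _); rewrite /upset -setUA; congr (_ :|: _).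
apply/setUidPr/subsetP=> y; rewrite !mem_bigcup_seq => /hasP[d dcs /andP[_ yd]].
by apply/hasP; exists d.
Qed.

(** One term of the recurrence: [M] is the set of rows to be merged, and stands in
    place of the first column, which need not be [M] itself. *)
Definition count_headed r b V E k M :=
  #|[set t : k.-tuple {set T} |
      [&& all (respects M) t, pairwise r t & admissible b V E (M :: t)]]|.

(** Here the first column is [M] itself. *)
Lemma count_respectsS b V E k :
  count_cols respects b V E k.+1 = \sum_M count_headed respects b V E k M.
Proof.
rewrite /count_cols (card_tuple_cons _ (fun t => pairwise respects t && admissible b V E t)).
by apply: eq_bigr => M _; apply: eq_card => t; rewrite !inE /= andbA.
Qed.

(** Replacing the first column by its bottom rows is a bijection that leaves the
    other columns unchanged. *)
Lemma count_nestedS b V E k :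
  count_cols nested b V E k.+1 = \sum_M count_headed nested b V E k M.
Proof.
pose S cs := [&& all (respects (head set0 cs)) (behead cs), pairwise nested (behead cs)
   & admissible b V E cs].
rewrite -(card_tuple_cons _ S).
pose f g (u : k.+1.-tuple {set T}) := cons_tuple (g (thead u) (behead u)) (behead_tuple u).
have fE (g : {set T} -> seq {set T} -> {set T}) c (t : k.-tuple {set T}) :
    f g (cons_tuple c t) = cons_tuple (g c t) t.
  by apply: val_inj; rewrite /= theadE.
apply: (@card_can_in _ _ _ _ (f bottom) (f upset)) => u; case/tupleP: u => c t;
  rewrite !inE ?fE /S /=.
- case/andP=> /andP[ct nt] A; rewrite bottom_respects // nt /=.
  by rewrite -upset_admissible bottomK.
- by case/and3P=> Mt nt A; rewrite nt upset_nested // upset_admissible.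
- by case/andP=> /andP[ct nt] A; apply: val_inj; rewrite /= bottomK.
- by case/and3P=> Mt nt A; apply: val_inj; rewrite /= upsetK.
Qed.

Lemma respects0 d : respects set0 d.
Proof. by rewrite /respects sub0set orbT. Qed.

Lemma count_headed0 r b V E k :
  count_headed r b V E k set0 = b * count_cols r b V E k.
Proof.
rewrite /count_headed /count_cols /admissible; case: b; rewrite ?mul1n ?mul0n.
  apply: eq_card => t; rewrite !inE /= sub0set big_cons set0U.
  suff -> : all (respects set0) t by [].
  by apply/allP=> d _; apply: respects0.
by apply/eqP; rewrite cards_eq0; apply/eqP/setP=> t; rewrite !inE /= eqxx !andbF.
Qed.

Lemma count_headed_out r b V E k M : ~~ (M \subset V) -> count_headed r b V E k M = 0.
Proof.
move=> /negPf MV; apply/eqP; rewrite cards_eq0; apply/eqP/setP=> t.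
by rewrite !inE /admissible /= MV !andbF.
Qed.

Lemma merge_respects M x d1 d2 : x \in M -> respects M d1 -> respects M d2 ->
  respects (merge M x d1) (merge M x d2) = respects d1 d2.
Proof. by move=> xM M1 M2; rewrite /respects (merge_disjoint xM) ?(merge_subset xM). Qed.

Lemma merge_nested M x d1 d2 : x \in M -> respects M d1 -> respects M d2 ->
  nested (merge M x d1) (merge M x d2) = nested d1 d2.
Proof. by move=> xM M1 M2; rewrite /nested !(merge_subset xM). Qed.

(** * The two counts *)

(** Both counts obey the same recurrence, term by term. *)
Lemma count_respects_nested b V E k :
  count_cols respects b V E k = count_cols nested b V E k.
Proof.
elim: k V E => [|k IH] V E.
  by apply: eq_card => t; rewrite !inE tuple0.
rewrite count_respectsS count_nestedS; apply: eq_bigr => M _.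
have [->|/set0Pn[x xM]] := eqVneq M set0; first by rewrite !count_headed0 IH.
have [MV|nMV] := boolP (M \subset V); last by rewrite !count_headed_out.
rewrite /count_headed !(card_merge E xM MV) //.
- by move=> d1 d2; apply: merge_nested.
- by move=> d1 d2; apply: merge_respects.
Qed.

(** The index is the size minus one, the number of rows lost by a merge. *)
Lemma sum_nonempty_subsets (R : pzSemiRingType) V (F : nat -> R) :
  (\sum_(M : {set T} | (M != set0) && (M \subset V)) F #|M|.-1
     = \sum_(s < #|V|) 'C(#|V|, s.+1)%:R * F s)%R.
Proof.
have cM M : (M != set0) && (M \subset V) -> 0 < #|M| <= #|V|.
  by rewrite card_gt0 => /andP[-> /subset_leq_card ->].
case Em: #|V| => [|m].
  by rewrite big_ord0 big1 // => M /cM; rewrite Em; case: #|M|.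
rewrite (partition_big (fun M : {set T} => inord #|M|.-1 : 'I_m.+1) xpredT) //=.
apply: eq_bigr => s _; rewrite -[X in 'C(X, _)]Em -cards_draws mulr_natl -sumr_const.
apply: eq_big => [M|M /andP[/cM]]; last first.
  by rewrite Em; case: #|M| => // c /andP[_ lec] /eqP <-; rewrite inordK.
rewrite inE; apply/idP/idP => [/andP[/[dup] /cM + /andP[_ ->]]|/andP[-> /eqP e]].
  by rewrite Em; case: #|M| => // c /andP[_ lec] /eqP <-; rewrite inordK /=.
have : 0 < #|M| by rewrite e.
by rewrite card_gt0 e => -> /=; rewrite inord_val.
Qed.

Lemma count_respects_poly_bernoulli V k :
  ((count_cols respects true V setT k)%:R = poly_bernoulli #|V| k)%R.
Proof.
elim: k V => [|k IH] V.
  rewrite poly_bernoulli0 /count_cols.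
  have -> : [set t : 0.-tuple {set T} | pairwise respects t && admissible true V setT t] = setT.
    by apply/setP=> t; rewrite !inE tuple0 /admissible /= setTU subsetT.
  by rewrite cardsT card_tuple.
rewrite count_respectsS poly_bernoulli_rec natr_sum (bigD1 set0) //=.
rewrite count_headed0 mul1n IH; congr (_ + _)%R.
rewrite (bigID (fun M : {set T} => M \subset V)) /= [X in (_ + X)%R]big1 ?addr0; last first.
  by move=> M /andP[_ /count_headed_out ->].
transitivity (\sum_(M | (M != set0) && (M \subset V)) poly_bernoulli (#|V| - #|M|.-1) k)%R.
  apply: eq_bigr => M /andP[/set0Pn[x xM] MV].
  rewrite /count_headed (card_merge setT xM MV) ?setUT ?IH; last first.
    by move=> d1 d2; apply: merge_respects.
  rewrite cardsU1 !inE xM /= cardsD (setIidPr MV) add1n.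
  have cM : 0 < #|M| by apply/card_gt0P; exists x.
  by rewrite -subSn ?subset_leq_card // -[in LHS](prednK cM) subSS.
exact: (sum_nonempty_subsets V (fun s => poly_bernoulli (#|V| - s) k)).
Qed.

End Columns.

(** * From matrices to columns *)

Section Matrices.
Variables n k : nat.
Implicit Types A : 'M[bool]_(n, k).

Definition columns A : k.-tuple {set 'I_n} := [tuple [set i | A i j] | j < k].

Lemma in_column A i j : (i \in tnth (columns A) j) = A i j.
Proof. by rewrite tnth_mktuple inE. Qed.

Lemma card_columns (P : pred (seq {set 'I_n})) :
  #|[set A : 'M[bool]_(n, k) | P (columns A)]|
    = #|[set t : k.-tuple {set 'I_n} | P t]|.
Proof.
pose mat (t : k.-tuple {set 'I_n}) : 'M[bool]_(n, k) := (\matrix_(i, j) (i \in tnth t j))%R.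
have matK : cancel mat columns.
  by move=> t; apply/eq_from_tnth=> j; apply/setP=> i; rewrite in_column mxE.
apply: (card_can_in (f := columns) (g := mat)) => [A|t|A _|t _]; rewrite ?inE ?matK //.
by apply/matrixP=> i j; rewrite mxE in_column.
Qed.

Lemma pairwise_columnsP (r : rel {set 'I_n}) A :
  reflect (forall j j' : 'I_k, j < j' -> r (tnth (columns A) j) (tnth (columns A) j'))
    (pairwise r (columns A)).
Proof.
apply: (iffP (pairwiseP set0)) => h.
  by move=> j j' lt_jj'; rewrite !(tnth_nth set0) h // inE size_tuple.
move=> j j'; rewrite !inE size_tuple => lt_j lt_j' lt_jj'.
by have := h (Ordinal lt_j) (Ordinal lt_j') lt_jj'; rewrite !(tnth_nth set0).
Qed.

Lemma cols_nonzeroE A : cols_nonzero A = (set0 \notin columns A).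
Proof.
apply/forallP/negP => [h /tnthP[j /setP e]|h j].
  have /existsP[i Aij] := h j.
  by have := e i; rewrite in_column Aij inE.
apply: contraT => /existsPn nA; case: h; apply/tnthP; exists j; apply/setP=> i.
by rewrite in_column inE (negPf (nA i)).
Qed.

Lemma rows_nonzeroE A : rows_nonzero A = (setT \subset \bigcup_(c <- columns A) c).
Proof.
apply/forallP/subsetP => h i; have := h i; rewrite ?inE mem_bigcup_seq.
  case/existsP=> j Aij _; apply/hasP; exists (tnth (columns A) j); first exact: mem_tnth.
  by rewrite /= in_column.
by case/(_ isT)/hasP=> c /tnthP[j ->] /=; rewrite in_column => Aij; apply/existsP; exists j.
Qed.

Lemma contains_mx22P A (a b c d : bool) :
  reflect (exists i i' : 'I_n, exists j j' : 'I_k,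
     [/\ i < i', j < j', A i j = a /\ A i j' = b & A i' j = c /\ A i' j' = d])
    (contains A (mx22 a b c d)).
Proof.
have incr m (f : {ffun 'I_2 -> 'I_m}) : increasing f = (f ord0 < f (lift ord0 ord0)).
  apply/forallP/idP => [/(_ ord0)/forallP/(_ (lift ord0 ord0))/implyP|lt_f x]; first exact.
  apply/forallP=> y; apply/implyP=> lt_xy.
  have -> : x = ord0 by apply: val_inj; case: x y lt_xy => [[|[|]]] // ? [[|[|]]].
  by have -> : y = lift ord0 ord0 by apply: val_inj; case: x y lt_xy => [[|[|]]] // ? [[|[|]]].
apply: (iffP existsP) => [[f /existsP[g /and3P[]]]|[i [i' [j [j' [lt_i lt_j [<- <-] [<- <-]]]]]]].
  rewrite !incr => lt_f lt_g /eqP/matrixP e.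
  exists (f ord0), (f (lift ord0 ord0)), (g ord0), (g (lift ord0 ord0)).
  by split=> //; split; [have := e ord0 ord0 | have := e ord0 (lift ord0 ord0)
    | have := e (lift ord0 ord0) ord0 | have := e (lift ord0 ord0) (lift ord0 ord0)];
    rewrite !mxE.
exists [ffun x => if x == ord0 then i else i']; apply/existsP.
exists [ffun x => if x == ord0 then j else j']; rewrite !incr !ffunE /= lt_i lt_j /=.
by apply/eqP/matrixP=> x y; rewrite !mxE !ffunE; case: (x == ord0); case: (y == ord0).
Qed.

(** In two rows that share a 1 in column [j], the patterns of [Q] are the two ways
    in which they can differ in a later column. *)
Lemma avoidsE A : avoids Q A = pairwise (@respects _) (columns A).
Proof.
apply/forallP/pairwise_columnsP => [h j j' lt_j | h P].
  apply: contraT; rewrite negb_or => /andP[/pred0Pn[i /andP[/= ij ij']] /subsetPn[i' i'j i'j']].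
  rewrite !in_column in ij ij' i'j i'j'.
  case: (ltngtP i i') => [lt_i|lt_i|/val_inj e]; last by rewrite -e ij' in i'j'.
  - have := h (mx22 true true true false); rewrite !inE eqxx /= => /contains_mx22P; case.
    by exists i, i', j, j'; rewrite ij ij' i'j (negPf i'j').
  - have := h (mx22 true false true true); rewrite !inE eqxx orbT /= => /contains_mx22P; case.
    by exists i', i, j, j'; rewrite ij ij' i'j (negPf i'j').
apply/implyP; rewrite !inE => /orP[] /eqP ->; apply/contains_mx22P;
  move=> [i [i' [j [j' [lt_i lt_j [ij ij'] [i'j i'j']]]]]]; have /orP[] := h j j' lt_j.
- by move/pred0P/(_ i); rewrite /= !in_column ij ij'.
- by move/subsetP/(_ i'); rewrite !in_column i'j i'j' => /(_ isT).
- by move/pred0P/(_ i'); rewrite /= !in_column i'j i'j'.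
- by move/subsetP/(_ i); rewrite !in_column ij ij' => /(_ isT).
Qed.

(** In a chain of columns the column [j] consists of the rows whose row sum is at
    least a threshold [th j]. Hence, for each column, among the sets of that
    size, it maximizes the total row sum, and strictly so. But the sum over all
    columns of these totals is the sum of the squares of the row sums, for [A'] as
    for [A], so that every column of [A'] attains its maximum. *)
Lemma nested_lonesum A : pairwise (@nested _) (columns A) -> lonesum A.
Proof.
move=> nA; apply/forallP=> A'; apply/implyP=> /andP[/forallP rA /forallP cA].
have chain j j' : nested (tnth (columns A) j) (tnth (columns A) j').
  have nr : reflexive (@nested 'I_n) by move=> z; rewrite /nested subxx.
  have ns : symmetric (@nested 'I_n) by move=> z1 z2; rewrite /nested orbC.
  by rewrite pairwise_all2rel // in nA; apply: (allrelP nA); apply: mem_tnth.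
have lt_row i i' j : A i j -> ~~ A i' j -> row_sum A i' < row_sum A i.
  move=> Aij Ai'j; have le j' : A i' j' <= A i j'.
    have := chain j j'; case Ai'j': (A i' j') => //; case/orP=> /subsetP s.
      by have := s i; rewrite !in_column => ->.
    by have := s i'; rewrite !in_column (negPf Ai'j) Ai'j' => /(_ isT).
  rewrite /row_sum (bigD1 j) //= [X in _ < X](bigD1 j) //= Aij (negPf Ai'j) add1n ltnS.
  exact: leq_sum.
(* The maximum is empty, hence 0, when the column is full, which is then a valid
   threshold as well. *)
pose th j := \max_(i | ~~ A i j) (row_sum A i).+1.
have th_out i j : ~~ A i j -> row_sum A i < th j.
  by move=> Aij; apply: (bigop.bigmax_sup i).
have th_in i j : A i j -> th j <= row_sum A i.
  by move=> Aij; apply/bigmax_leqP=> i' Ai'j; apply: lt_row Aij Ai'j.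
have sumE : \sum_(p : 'I_n * 'I_k) (A' p.1 p.2 * row_sum A p.1 + A p.1 p.2 * th p.2)
  = \sum_(p : 'I_n * 'I_k) (A p.1 p.2 * row_sum A p.1 + A' p.1 p.2 * th p.2).
  have byrow (B : 'M[bool]_(n, k)) : \sum_(p : 'I_n * 'I_k) B p.1 p.2 * row_sum A p.1
      = \sum_i row_sum B i * row_sum A i.
    rewrite -(pair_bigA _ (fun i j => B i j * row_sum A i)) /=.
    by apply: eq_bigr => i _; rewrite big_distrl.
  have bycol (B : 'M[bool]_(n, k)) : \sum_(p : 'I_n * 'I_k) B p.1 p.2 * th p.2
      = \sum_j col_sum B j * th j.
    rewrite -(pair_bigA _ (fun i j => B i j * th j)) /= exchange_big.
    by apply: eq_bigr => j _; rewrite big_distrl.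
  rewrite !big_split /= !byrow !bycol; congr (_ + _); apply: eq_bigr => x _.
    by rewrite (eqP (rA x)).
  by rewrite (eqP (cA x)).
have term (p : 'I_n * 'I_k) : A' p.1 p.2 * row_sum A p.1 + A p.1 p.2 * th p.2
   <= A p.1 p.2 * row_sum A p.1 + A' p.1 p.2 * th p.2 ?= iff
  (A' p.1 p.2 * row_sum A p.1 + A p.1 p.2 * th p.2
   == A p.1 p.2 * row_sum A p.1 + A' p.1 p.2 * th p.2).
  split=> //; case: p => i j /=; case Aij: (A i j); case: (A' i j);
    rewrite ?mul1n ?mul0n ?addn0 ?add0n //.
  - by rewrite th_in.
  - by apply/ltnW/th_out; rewrite Aij.
have [_] := leqif_sum (P := xpredT) (fun p _ => term p).
rewrite sumE eqxx => /esym/forallP eqs.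
have sub i j : A' i j -> A i j.
  move=> A'ij; apply: contraT => Aij; have := eqs (i, j).
  by rewrite /= A'ij (negPf Aij) !mul1n !mul0n addn0 add0n ltn_eqF // th_out.
apply/eqP/matrixP=> i j.
(* [A'] is contained in [A], and the column sums agree. *)
have le i' : xpredT i' -> A' i' j <= A i' j ?= iff (A' i' j == A i' j :> nat).
  by move=> _; split=> //; case e: (A' i' j) => //; rewrite (sub _ _ e).
have [_] := leqif_sum le.
rewrite -/(col_sum A' j) -/(col_sum A j) (eqP (cA j)) eqxx => /esym/forallP/(_ i)/=.
by case: (A' i j); case: (A i j).
Qed.

(** If two columns are not comparable, two rows exhibit a permutation matrix
    of size 2 in them. Exchanging its 0s and 1s gives a second matrix with the
    same sums. *)
Lemma lonesum_nested A : lonesum A -> pairwise (@nested _) (columns A).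
Proof.
move/forallP=> lA; apply/pairwise_columnsP=> j j' _; apply: contraT.
rewrite negb_or => /andP[/subsetPn[i ij ij'] /subsetPn[i' i'j' i'j]].
rewrite !in_column in ij ij' i'j i'j'.
pose A' : 'M[bool]_(n, k) := (\matrix_(x, y)
  if (x \in [:: i; i']) && (y \in [:: j; j']) then ~~ A x y else A x y)%R.
(* On the chosen 2 x 2 minor, negation is the exchange of the two columns and
   also that of the two rows. *)
have rowE x y : A' x y = A x ((if x \in [:: i; i'] then tperm j j' else 1%g) y).
  rewrite mxE; case: ifP => /=; last first.
    case: ifP => //; rewrite ?perm1 //= !inE => _ /negbT; rewrite negb_or => /andP[yj yj'].
    by rewrite tpermD // eq_sym.
  case/andP=> + +; rewrite !inE => xi yj; rewrite xi.
  case/orP: xi => /eqP ->; case/orP: yj => /eqP ->; rewrite ?tpermL ?tpermR;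
    by rewrite ?ij ?i'j' ?(negPf ij') ?(negPf i'j).
have colE x y : A' x y = A ((if y \in [:: j; j'] then tperm i i' else 1%g) x) y.
  rewrite mxE andbC; case: ifP => /=; last first.
    case: ifP => //; rewrite ?perm1 //= !inE => _ /negbT; rewrite negb_or => /andP[yj yj'].
    by rewrite tpermD // eq_sym.
  case/andP=> + +; rewrite !inE => yj xi; rewrite yj.
  case/orP: xi => /eqP ->; case/orP: yj => /eqP ->; rewrite ?tpermL ?tpermR;
    by rewrite ?ij ?i'j' ?(negPf ij') ?(negPf i'j).
have /implyP/(_ _)/eqP/matrixP/(_ i j) := lA A'.
rewrite rowE inE eqxx tpermL ij (negPf ij'); apply.
apply/andP; split; apply/forallP.
  move=> x; rewrite /row_sum; apply/eqP; under eq_bigr do rewrite rowE.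
  by rewrite [RHS](reindex_inj (@perm_inj _ (if x \in [:: i; i'] then tperm j j' else 1%g))).
move=> y; rewrite /col_sum; apply/eqP; under eq_bigr do rewrite colE.
by rewrite [RHS](reindex_inj (@perm_inj _ (if y \in [:: j; j'] then tperm i i' else 1%g))).
Qed.

Lemma lonesumE A : lonesum A = pairwise (@nested _) (columns A).
Proof. by apply/idP/idP; [apply: lonesum_nested | apply: nested_lonesum]. Qed.

Lemma count_cols_columns (r : rel {set 'I_n}) b E :
  #|[set A : 'M[bool]_(n, k) |
      pairwise r (columns A) && admissible b setT E (columns A)]|
   = count_cols r b setT E k.
Proof. exact: (card_columns (fun cs => pairwise r cs && admissible b setT E cs)). Qed.

Lemma admissible_columns b E A :
  admissible b setT E (columns A)
   = (b || cols_nonzero A) && (setT \subset E :|: \bigcup_(c <- columns A) c).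
Proof.
rewrite /admissible cols_nonzeroE.
have -> // : all (fun c : {set 'I_n} => c \subset setT) (columns A).
by apply/allP=> c _; apply: subsetT.
Qed.

End Matrices.

Theorem theorem7 (n k : nat) (hn : (1 <= n)%N) (hk : (1 <= k)%N) :
  [/\ (#|[set A : 'M[bool]_(n, k) | avoids Q A]|%:R = poly_bernoulli n k)%R,
      #|[set A : 'M[bool]_(n, k) | avoids Q A && cols_nonzero A]|
        = C_number n k
    & #|[set A : 'M[bool]_(n, k) |
          [&& avoids Q A, rows_nonzero A & cols_nonzero A]]|
        = D_number n k].
Proof.
split.
- rewrite -[in RHS](card_ord n) -cardsT -count_respects_poly_bernoulli -count_cols_columns.
  congr (_%:R)%R; apply: eq_card => A.
  by rewrite !inE avoidsE admissible_columns setTU subsetT /= !andbT.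
- transitivity (count_cols (@respects 'I_n) false setT setT k).
    rewrite -count_cols_columns; apply: eq_card => A.
    by rewrite !inE avoidsE admissible_columns setTU subsetT /= !andbT.
  rewrite count_respects_nested -count_cols_columns; apply: eq_card => A.
  by rewrite !inE lonesumE admissible_columns setTU subsetT /= !andbT.
- transitivity (count_cols (@respects 'I_n) false setT set0 k).
    rewrite -count_cols_columns; apply: eq_card => A.
    by rewrite !inE avoidsE admissible_columns set0U -rows_nonzeroE [cols_nonzero A && _]andbC.
  rewrite count_respects_nested -count_cols_columns; apply: eq_card => A.
  by rewrite !inE lonesumE admissible_columns set0U -rows_nonzeroE [cols_nonzero A && _]andbC.
Qed.
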